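(* Let $g=dx_1^2+e^{2x_1}dx_2^2+e^{-2x_1}dx_3^2$ be the metric of the geometry $\mathrm{Sol}$ on $\mathbb R^3$ and let $$E=-4x_3\frac{\partial}{\partial x_3}-2\frac{\partial}{\partial x_1}.$$ Then $-2\,\mathrm{Ricci}(g)=\mathcal L_Eg+2Ag$ with $A=2$, so that $(\mathbb R^3,g)$ with $E$ is a Ricci soliton; and it is not of gradient type: the $1$-form $E^\flat=g(E,\cdot)$ is not closed, so $E$ is not the gradient of a function.
   Context: A Ricci soliton is a Riemannian manifold $(M,g)$ with a vector field $E$ and a constant $A$ such that $-2\,\mathrm{Ricci}(g)=\mathcal L_Eg+2Ag$. It is of gradient type if $E=\mathrm{grad}\,F$ for some function $F$. *)

(* Defs.v *)
From mathcomp Require Import all_boot all_order all_algebra.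
From mathcomp Require Import all_classical all_reals all_analysis.
Import Order.TTheory GRing.Theory Num.Theory.
Import numFieldNormedType.Exports.

Set Implicit Arguments.
Unset Strict Implicit.
Unset Printing Implicit Defensive.

Local Open Scope ring_scope.

(* Riemannian geometry of R^n in its global coordinate chart. Points, tangent
   vectors and covectors are row vectors, given by their components in the
   bases d/dx_i and dx_i; a (0,2)-tensor is the matrix of its components.
   Coordinate indices start at 0. *)

Section Geometry.
Variables (R : realType) (n : nat).
Local Notation pt := 'rV[R]_n.

Implicit Types (f : pt -> R) (g : pt -> 'M[R]_n) (E w : pt -> 'rV[R]_n).

Definition partial (i : 'I_n) f (x : pt) : R := 'D_(delta_mx 0 i) f x.

Fixpoint Ck (k : nat) f : Prop :=
  if k is k'.+1 then
    forall i, (forall x, derivable f x (delta_mx 0 i)) /\ Ck k' (partial i f)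
  else continuous f.

Definition smooth f : Prop := forall k, Ck k f.

Definition smooth_field E : Prop := forall i, smooth (fun x => E x 0 i).

Definition inner g (x : pt) (v w : 'rV[R]_n) : R := (v *m g x *m w^T) 0 0.

Record riemannian g : Prop := Riemannian {
  metric_smooth : forall i j, smooth (fun x => g x i j);
  metric_sym : forall x, (g x)^T = g x;
  metric_posdef : forall x v, v != 0 -> 0 < inner g x v v }.

(* Gamma^k_ij of the Levi-Civita connection:
   nabla_(d_i) d_j = \sum_k Gamma^k_ij d_k. *)
Definition christoffel g (k i j : 'I_n) (x : pt) : R :=
  2^-1 * \sum_l invmx (g x) k l *
    (partial i (fun y => g y j l) x + partial j (fun y => g y i l) x
     - partial l (fun y => g y i j) x).

(* R(d_i, d_j) d_k = \sum_l (riemann g l i j k) d_l, with the convention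
   R(X, Y) = [nabla_X, nabla_Y] - nabla_[X, Y]. *)
Definition riemann g (l i j k : 'I_n) (x : pt) : R :=
  partial i (christoffel g l j k) x - partial j (christoffel g l i k) x
  + \sum_m (christoffel g l i m x * christoffel g m j k x
            - christoffel g l j m x * christoffel g m i k x).

(* Ric(Y, Z) is the trace of X |-> R(X, Y) Z, so that round spheres have
   positive Ricci curvature. *)
Definition ricci g (x : pt) : 'M[R]_n :=
  \matrix_(j, k) \sum_i riemann g i i j k x.

(* (L_E g)(d_i, d_j) = E (g_ij) - g([E, d_i], d_j) - g(d_i, [E, d_j]), where
   [E, d_i] = - \sum_k (d_i E^k) d_k. *)
Definition lie_metric E g (x : pt) : 'M[R]_n :=
  \matrix_(i, j) \sum_k (E x 0 k * partial k (fun y => g y i j) x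
    + partial i (fun y => E y 0 k) x * g x k j
    + partial j (fun y => E y 0 k) x * g x i k).

Definition ricci_soliton g E (A : R) : Prop :=
  [/\ riemannian g, smooth_field E &
      forall x, (- 2) *: ricci g x = lie_metric E g x + (2 * A) *: g x].

Definition flat g E (x : pt) : 'rV[R]_n :=
  \row_j inner g x (E x) (delta_mx 0 j).

(* Component of dw on d_i, d_j; meaningful for differentiable w. *)
Definition ext_d w (i j : 'I_n) (x : pt) : R :=
  partial i (fun y => w y 0 j) x - partial j (fun y => w y 0 i) x.

Definition closed_form w : Prop := forall i j x, ext_d w i j x = 0.

(* f is only asked to be differentiable; when g and E are smooth this forces
   f to be smooth. *)
Definition is_grad g f E : Prop :=
  forall x, differentiable f x /\ forall v, inner g x (E x) v = 'd f x v.

Definition gradient_type g E : Prop := exists F : pt -> R, is_grad g F E.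

End Geometry.

(* The coordinates x_1, x_2, x_3 are x 0 0, x 0 1, x 0 2; dx_i^2 is the matrix unit
   with its 1 in the i-th diagonal entry. *)
Definition sol_metric (R : realType) (x : 'rV[R]_3) : 'M[R]_3 :=
  delta_mx 0 0 + expR (2 * x 0 0) *: delta_mx 1 1
  + expR (- 2 * x 0 0) *: delta_mx 2 2.

Definition sol_field (R : realType) (x : 'rV[R]_3) : 'rV[R]_3 :=
  (- 4 * x 0 2) *: delta_mx 0 2 - 2 *: delta_mx 0 0.

(* Main.v *)
(* In coordinates g_ij = delta_ij exp(w_i x_0) with w = (0, 2, -2). Hence the Christoffel
   symbols are constants plus multiples of a single exponential exp(w_i x_0), and the
   Ricci tensor reduces to -2 dx_0^2. The form g(E, .) = -2 dx_0 - 4 x_2 exp(-2 x_0) dx_2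
   is not closed. A potential is only assumed differentiable, so its mixed second
   derivatives cannot be compared; translation along x_0 is used instead. *)

Require Import Defs.
From mathcomp Require Import all_boot all_order all_algebra.
From mathcomp Require Import all_classical all_reals all_analysis.
From mathcomp Require Import ring lra.
Import Order.TTheory GRing.Theory Num.Theory.
Import numFieldNormedType.Exports.
Set Implicit Arguments.
Unset Strict Implicit.
Unset Printing Implicit Defensive.
Local Open Scope ring_scope.

(** * Indices in ['I_3] and derivatives along a line *)

Lemma ord3_ind (P : 'I_3 -> Prop) : P 0 -> P 1 -> P 2 -> forall i, P i.
Proof.
move=> P0 P1 P2 [[|[|[|//]]] lti].
- by rewrite (_ : Ordinal lti = 0) //; exact: val_inj.
- by rewrite (_ : Ordinal lti = 1) //; exact: val_inj.
- by rewrite (_ : Ordinal lti = 2) //; exact: val_inj.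
Qed.

Lemma sum_ord3 (V : nmodType) (F : 'I_3 -> V) : \sum_i F i = F 0 + F 1 + F 2.
Proof.
rewrite !big_ord_recr big_ord0 /= add0r.
by congr (F _ + F _ + F _); exact: val_inj.
Qed.

(** A directional derivative sees a function only along one line, so it transfers even between
    different domains, such as R and R^n. *)
Lemma is_derive_line_eq (R : realType) (V1 V2 W : normedModType R)
    (f1 : V1 -> W) (f2 : V2 -> W) a1 v1 a2 v2 (d : W) :
  (forall h : R, f1 (h *: v1 + a1) = f2 (h *: v2 + a2)) ->
  is_derive a1 v1 f1 d -> is_derive a2 v2 f2 d.
Proof.
move=> eqf.
have eqa : f1 a1 = f2 a2 by have := eqf 0; rewrite !scale0r !add0r.
have eqq : (fun h : R => h^-1 *: ((f1 \o shift a1) (h *: v1) - f1 a1)) =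
           (fun h : R => h^-1 *: ((f2 \o shift a2) (h *: v2) - f2 a2)).
  by apply/funext => h /=; rewrite eqf eqa.
by case=> df Df; split; [rewrite /derivable -eqq | rewrite /derive -eqq].
Qed.

(** * Functions of a single coordinate *)

Section Coordinates.
Variables (R : realType) (n : nat).
Implicit Types (x : 'rV[R]_n) (i j : 'I_n).

(** Along the j-th axis the i-th coordinate is the line parameter up to a shift when i = j, and
    constant otherwise. *)
Lemma is_derive_coord (phi : R -> R) i j x d :
  is_derive (x 0 i) 1 phi d ->
  is_derive x (delta_mx 0 j) (fun y => phi (y 0 i)) ((i == j)%:R * d).
Proof.
move=> dphi; case: (eqVneq i j) => [<-|nij]; rewrite ?mul1r ?mul0r.
  by apply: is_derive_line_eq dphi => h; rewrite !mxE !eqxx [_ *: 1]mulr1 mulr1.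
apply: is_derive_line_eq (is_derive_cst (phi (x 0 i)) x (0 : 'rV[R]_n)) => h.
by rewrite !mxE (negPf nij) andbF mulr0 add0r.
Qed.

Lemma partial_val i (f : 'rV[R]_n -> R) x d :
  is_derive x (delta_mx 0 i) f d -> partial i f x = d.
Proof. by case. Qed.

Lemma is_derive_coord_exp (c a : R) i j x :
  is_derive x (delta_mx 0 j) (fun y => c * expR (a * y 0 i))
    ((i == j)%:R * (c * a) * expR (a * x 0 i)).
Proof.
rewrite -mulrA; apply: (@is_derive_coord (fun t => c * expR (a * t))).
apply: is_derive_eq; rewrite /GRing.scale /=; ring.
Qed.

Lemma continuous_coord (phi : R -> R) i :
  (forall t, derivable phi t 1) -> continuous (fun x : 'rV[R]_n => phi (x 0 i)).
Proof.
move=> dphi x; apply: (@continuous_comp _ _ _ (fun y : 'rV[R]_n => y 0 i) phi).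
  exact: coord_continuous.
exact/differentiable_continuous/derivable1_diffP.
Qed.

Lemma smooth_coord_exp (c a : R) i :
  smooth (fun x : 'rV[R]_n => c * expR (a * x 0 i)).
Proof.
(* The coefficient [c] is generalized: a partial derivative changes it but keeps the exponential. *)
move=> k; elim: k c => [|k IHk] c /=.
  by apply: (@continuous_coord (fun t => c * expR (a * t))) => t; exact: ex_derive.
move=> j; split=> [x|]; first by case: (is_derive_coord_exp c a i j x).
rewrite (_ : partial _ _ = fun x => (i == j)%:R * (c * a) * expR (a * x 0 i)) //.
by apply/funext => x; exact/partial_val/is_derive_coord_exp.
Qed.

Lemma smooth_cst (c : R) : smooth (fun _ : 'rV[R]_n => c).
Proof.
move=> k; elim: k c => [|k IHk] c /=; first exact: cst_continuous.
move=> j; split=> [x|]; first exact: derivable_cst.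
rewrite (_ : partial _ _ = fun=> 0) //.
by apply/funext => x; exact/partial_val.
Qed.

Lemma is_derive_coord_affine (c b : R) i j x :
  is_derive x (delta_mx 0 j) (fun y => c * y 0 i + b) (c * (i == j)%:R).
Proof.
rewrite mulrC; apply: (@is_derive_coord (fun t => c * t + b)).
apply: is_derive_eq; rewrite /GRing.scale /=; ring.
Qed.

Lemma smooth_coord_affine (c b : R) i : smooth (fun x : 'rV[R]_n => c * x 0 i + b).
Proof.
case=> [|k] /=.
  by apply: (@continuous_coord (fun t => c * t + b)) => t; exact: ex_derive.
move=> j; split=> [x|]; first by case: (is_derive_coord_affine c b i j x).
rewrite (_ : partial _ _ = fun=> c * (i == j)%:R); first exact: smooth_cst.
by apply/funext => x; exact/partial_val/is_derive_coord_affine.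
Qed.

End Coordinates.

(** * Curvature of the Sol metric *)

Section Sol.
Variable R : realType.
Implicit Types (x : 'rV[R]_3) (i j k l : 'I_3).

Definition sol_weight (i : 'I_3) : R := if i == 1 then 2 else if i == 2 then - 2 else 0.
Local Notation w := sol_weight.

Lemma sol_metricE x i j :
  sol_metric x i j = (i == j)%:R * expR (w i * x 0 0).
Proof.
rewrite /sol_metric !mxE; elim/ord3_ind: i; elim/ord3_ind: j;
rewrite /w /= ?(mulr0, mul0r, addr0, add0r, mulr1, mul1r, expR0) //.
Qed.

Lemma sol_field0E x i : sol_field x 0 i = (- 4 * (i == 2)%:R) * x 0 2 + (- 2 * (i == 0)%:R).
Proof. by rewrite /sol_field !mxE /=; ring. Qed.

Lemma invmx_sol_metric x :
  invmx (sol_metric x) = \matrix_(i, j) ((i == j)%:R * expR (- (w i * x 0 0))).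
Proof.
set h := (RHS).
have gh : sol_metric x *m h = 1%:M.
  apply/matrixP => i j; rewrite mxE [RHS]mxE (bigD1 i) //= big1 => [|k nki].
    by rewrite sol_metricE mxE eqxx mul1r addr0 mulrCA -expRD subrr expR0 mulr1.
  by rewrite sol_metricE eq_sym (negPf nki) !mul0r.
have [gU _] := mulmx1_unit gh.
by rewrite -[LHS]mulmx1 -gh mulKmx.
Qed.

Lemma partial_sol_metric l i j x :
  partial l (fun y => sol_metric y i j) x =
  (0 == l)%:R * ((i == j)%:R * w i) * expR (w i * x 0 0).
Proof.
under eq_fun do rewrite sol_metricE.
exact/partial_val/is_derive_coord_exp.
Qed.

(** Gamma^k_0k = Gamma^k_k0 = w_k / 2: the inverse metric cancels the exponential in d_0 g_kk. *)
Definition sol_christoffel_cst k i j : R :=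
  2^-1 * w k * (((0 == i) && (j == k))%:R + ((0 == j) && (i == k))%:R).
(** Gamma^0_ii = - (w_i / 2) exp(w_i x_0): the exponential survives because g^00 = 1. *)
Definition sol_christoffel_exp k i j : R := - 2^-1 * w i * ((0 == k) && (i == j))%:R.

Lemma christoffel_solE k i j : christoffel (@sol_metric R) k i j =
  fun x => sol_christoffel_exp k i j * expR (w i * x 0 0) + sol_christoffel_cst k i j.
Proof.
apply/funext => x; rewrite /christoffel invmx_sol_metric (bigD1 k) //= big1 => [|l nlk].
  rewrite mxE eqxx !partial_sol_metric /sol_christoffel_exp /sol_christoffel_cst.
  (* Every exponential becomes a power of this one, so [field] needs only that it is nonzero. *)
  have e0 : expR (2 * x 0 0) != 0 by rewrite gt_eqF ?expR_gt0.
  elim/ord3_ind: k; elim/ord3_ind: i; elim/ord3_ind: j;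
    rewrite /w /= ?mulNr ?opprK ?expRN ?mul0r ?oppr0 ?expR0; by field.
by rewrite mxE eq_sym (negPf nlk) !mul0r.
Qed.

Lemma partial_christoffel_sol l k i j x :
  partial l (christoffel (@sol_metric R) k i j) x =
  (0 == l)%:R * (sol_christoffel_exp k i j * w i) * expR (w i * x 0 0).
Proof.
rewrite christoffel_solE; apply: partial_val; apply: is_derive_eq.
  by apply: is_deriveD; exact: is_derive_coord_exp.
by rewrite addr0.
Qed.

(** Ric_00 = - (w_1^2 + w_2^2) / 4 = -2. For j = 1, 2 the trace term of Ric_jj carries the factor
    w_0 + w_1 + w_2 = 0, and d_0 Gamma^0_jj cancels against the two products of Gamma^0_jj with
    Gamma^j_0j. *)
Lemma ricci_sol x : ricci (@sol_metric R) x = - 2 *: delta_mx 0 0.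
Proof.
apply/matrixP => j k; rewrite !mxE sum_ord3 /riemann !sum_ord3.
rewrite !partial_christoffel_sol !christoffel_solE.
rewrite /sol_christoffel_exp /sol_christoffel_cst.
elim/ord3_ind: j; elim/ord3_ind: k; rewrite /w /= ?mul0r ?expR0; by field.
Qed.

Lemma partial_sol_field l i x :
  partial l (fun y => sol_field y 0 i) x = - 4 * (i == 2)%:R * (2 == l)%:R.
Proof.
under eq_fun do rewrite sol_field0E.
exact/partial_val/is_derive_coord_affine.
Qed.

Lemma riemannian_sol : riemannian (@sol_metric R).
Proof.
split=> [i j|x|x v v0].
- under eq_fun do rewrite sol_metricE.
  exact: smooth_coord_exp.
- apply/matrixP => i j; rewrite mxE !sol_metricE.
  by case: (eqVneq j i) => [->|]; rewrite ?eqxx // !mul0r.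
have -> : inner (@sol_metric R) x v v = \sum_i v 0 i ^+ 2 * expR (w i * x 0 0).
  rewrite /inner mxE; apply: eq_bigr => i _; rewrite [X in _ * X]mxE mxE (bigD1 i) //= big1.
    by rewrite sol_metricE eqxx /=; ring.
  by move=> k nki; rewrite sol_metricE (negPf nki) mul0r mulr0.
have ge0 i : 0 <= v 0 i ^+ 2 * expR (w i * x 0 0).
  by rewrite mulr_ge0 ?sqr_ge0 ?expR_ge0.
(* If the sum of these nonnegative terms vanishes, so does each of them, hence each v_i. *)
rewrite lt_def sumr_ge0 // andbT; apply: contra v0 => /eqP s0.
apply/eqP/rowP => i; rewrite mxE.
have /eqP := psumr_eq0P (fun j _ => ge0 j) s0 (i := i) isT.
by rewrite mulf_eq0 sqrf_eq0 [expR _ == 0]gt_eqF ?expR_gt0 // orbF => /eqP.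
Qed.

(** The component -2 d_0 of the field contributes -4 g_11 and +4 g_22 to the Lie derivative, and -4
    x_2 d_2 contributes -8 g_22. Adding 4 g leaves 4 dx_0^2, which is -2 Ric. *)
Lemma ricci_soliton_sol : ricci_soliton (@sol_metric R) (@sol_field R) 2.
Proof.
split=> [|i|x]; first exact: riemannian_sol.
  under eq_fun do rewrite sol_field0E.
  exact: smooth_coord_affine.
rewrite ricci_sol; apply/matrixP => i j; rewrite !mxE -!/(sol_metric x i j) !sum_ord3.
rewrite !partial_sol_field !partial_sol_metric !sol_field0E !sol_metricE.
elim/ord3_ind: i; elim/ord3_ind: j; rewrite /w /= ?mul0r ?expR0; ring.
Qed.

(** * The dual 1-form and the absence of a potential *)

Lemma inner_sol_field x i :
  inner (@sol_metric R) x (sol_field x) (delta_mx 0 i) =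
  sol_field x 0 i * expR (w i * x 0 0).
Proof.
rewrite /inner mxE (bigD1 i) //= big1 => [|k nki].
  rewrite [X in _ * X]mxE [X in _ * X]mxE !eqxx mxE (bigD1 i) //= big1 => [|k nki].
    by rewrite sol_metricE eqxx /=; ring.
  by rewrite sol_metricE (negPf nki) mul0r mulr0.
by rewrite [X in _ * X]mxE [X in _ * X]mxE (negPf nki) andbF mulr0.
Qed.

Lemma flat_sol x i :
  flat (@sol_metric R) (@sol_field R) x 0 i = sol_field x 0 i * expR (w i * x 0 0).
Proof. by rewrite mxE inner_sol_field. Qed.

Lemma flat_sol_not_closed : ~ closed_form (flat (@sol_metric R) (@sol_field R)).
Proof.
(* The (0, 2) component of the exterior derivative is 8 x_2 exp(-2 x_0), which is 8 at this
   point. *)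
move=> /(_ 0 2 (delta_mx 0 2)); rewrite /ext_d.
under eq_fun do rewrite flat_sol.
under [X in _ - partial _ X _]eq_fun do rewrite flat_sol.
have -> : (fun y : 'rV[R]_3 => sol_field y 0 0 * expR (w 0 * y 0 0)) = fun=> - 2.
  by apply/funext => y; rewrite sol_field0E /w /= mul0r expR0; ring.
have -> : partial 2 (fun _ : 'rV[R]_3 => - 2) (delta_mx 0 2) = 0 :> R.
  exact/partial_val.
have -> : partial 0 (fun y : 'rV[R]_3 => sol_field y 0 2 * expR (w 2 * y 0 0))
    (delta_mx 0 2) = 8.
  set p := delta_mx 0 2 : 'rV[R]_3.
  have dfield : is_derive p (delta_mx 0 0) (fun y => sol_field y 0 2) 0.
    under eq_fun do rewrite sol_field0E.
    by apply: is_derive_eq; [exact: is_derive_coord_affine | rewrite mulr0].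
  have dexp : is_derive p (delta_mx 0 0) (fun y => expR (w 2 * y 0 0)) (- 2).
    apply: is_derive_eq; first exact: (@is_derive_coord R 3 (fun t => expR (w 2 * t))).
    by rewrite /w !mxE /= mulr0 expR0 /GRing.scale /=; ring.
  apply: partial_val; apply: (is_derive_eq (is_deriveM dfield dexp)).
  by rewrite sol_field0E /w !mxE /= mulr0 expR0 /GRing.scale /=; ring.
by rewrite subr0 => /eqP; rewrite pnatr_eq0.
Qed.

(* Along e0 the derivative of F is the constant -2, so F(e0 + y) = F(y) - 2 and
   d_2 F is invariant under translation by e0, whereas -4 x_2 exp(-2 x_0) is not. *)
Lemma sol_not_gradient : ~ gradient_type (@sol_metric R) (@sol_field R).
Proof.
case=> F gradF.
have dF x i : is_derive x (delta_mx 0 i) F (sol_field x 0 i * expR (w i * x 0 0)).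
  have [diffF gF] := gradF x.
  apply: DeriveDef; first exact: diff_derivable.
  by rewrite deriveE // -gF inner_sol_field.
pose e0 : 'rV[R]_3 := delta_mx 0 0.
have shiftF y : F (e0 + y) + 2 = F y.
  (* The term 2 s offsets the slope -2, so the function is constant; its values at s = 1 and s = 0
     are then compared. *)
  have dline (t : R) : is_derive t (1 : R) (fun s : R => F (s *: e0 + y) + 2 * s) 0.
    have dFt : is_derive t (1 : R) (fun s : R => F (s *: e0 + y)) (- 2).
      have <- : sol_field (t *: e0 + y) 0 0 * expR (w 0 * (t *: e0 + y) 0 0) = - 2.
        by rewrite sol_field0E /w /= mul0r expR0; ring.
      apply: is_derive_line_eq (dF (t *: e0 + y) 0) => h.
      by rewrite addrA -scalerDl [h *: 1]mulr1.
    by apply: is_derive_eq; rewrite /GRing.scale /=; ring.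
  have := is_derive_0_is_cst 1 0 dline.
  by rewrite scale1r scale0r add0r mulr1 mulr0 addr0.
pose e2 : 'rV[R]_3 := delta_mx 0 2.
(* By [shiftF] the derivative of F at e0 + e2 is also its derivative at e2. *)
have d1 : is_derive e2 e2 F (sol_field (e0 + e2) 0 2 * expR (w 2 * (e0 + e2) 0 0)).
  have dF2 := is_deriveD (dF (e0 + e2) 2) (is_derive_cst (2 : R) (e0 + e2) e2).
  rewrite addr0 in dF2; apply: is_derive_line_eq dF2 => h.
  by rewrite -[RHS]shiftF (addrCA e0).
have := @derive_val _ _ _ _ _ _ _ d1.
have [_ ->] := dF e2 2.
(* The two values of d_2 F at e2 are -4 exp(-2) and -4. *)
rewrite !sol_field0E /w !mxE /= => E.
have : expR (- 2 : R) = 1.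
  by move: E; rewrite !(addr0, add0r, mulr0, mulr1, expR0) => E; lra.
by rewrite -[RHS]expR0 => /expR_inj/eqP; rewrite oppr_eq0 pnatr_eq0.
Qed.

End Sol.

Theorem mainTheorem4 (R : realType) :
  ricci_soliton (@sol_metric R) (@sol_field R) 2 /\
  ~ closed_form (flat (@sol_metric R) (@sol_field R)) /\
  ~ gradient_type (@sol_metric R) (@sol_field R).
Proof.
split; first exact: ricci_soliton_sol.
by split; [exact: flat_sol_not_closed | exact: sol_not_gradient].
Qed.
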